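(* $$\zeta(3) = \frac{5\pi^3}{72\sqrt{3}} - \frac{1}{2} S_3(2\pi\sqrt{3}) - \frac{3}{2} S_3\!\left(\frac{2\pi\sqrt{3}}{3}\right).$$
   Context: For $x > 0$, $S_3(x) = \sum_{n=1}^{\infty} \frac{1}{n^3 (e^{xn} - 1)}$; $\zeta$ is the Riemann zeta function. *)

(* Defs.v *)
From Stdlib Require Import Reals.
From Coquelicot Require Import Coquelicot.
Local Open Scope R_scope.

(* Series are indexed from 0, so the n-th term of a sum over n >= 1 is taken
   at S n. *)

(* The Riemann zeta function on the real half-line s > 1, where it is given by
   its Dirichlet series; the value for s <= 1 is junk (the series diverges and
   no continuation is taken). *)
Definition zeta (s : R) : R :=
  Series (fun n : nat => / Rpower (INR (S n)) s).

(* Meaningful for x > 0, where every denominator is positive and the series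
   converges. *)
Definition S3 (x : R) : R :=
  Series (fun n : nat => / (INR (S n) ^ 3 * (exp (x * INR (S n)) - 1))).

(* Main.v *)
Require Import Defs.
From Stdlib Require Import Reals Lra Lia.
From Coquelicot Require Import Coquelicot.
Local Open Scope R_scope.

(* Write [pi coth (pi n t) = 1/(nt) + 2nt sum_m 1/(m^2 + t^2 n^2)]. Dividing by [n^3] and summing
   over [n] expresses [zeta(3) + 2 S3(2 pi t)] through [zeta(4)] and the double sum
   [A(t) = sum_{n,m} 1/(n^2 (m^2 + t^2 n^2))]. All terms are positive, and
   [1/(n^2 (m^2 + t^2 n^2)) + 1/(m^2 (n^2 + t^-2 m^2)) = 1/(n^2 m^2)], hence
   [A(t) + A(1/t) = zeta(2)^2]; the theorem is the case [t = sqrt 3].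

   The partial fractions of coth come from the integrals [I_m] and [J_m] over [0, pi/2] of
   [cosh(2xt) cos^m t] and of its [x]-derivative: [J_{2k}/I_{2k}] tends to 0, starts at
   [pi coth(pi x) - 1/x], and decreases by [2x/(k^2 + x^2)] at the [k]-th step. Comparing their
   expansions as [x -> 0] gives [zeta(2)] and [zeta(4)]. *)

(** * Integrals of hyperbolic functions against powers of cosine *)

Lemma is_RInt_antiderivative (F f : R -> R) (a b : R) :
  (forall t, is_derive F t (f t)) -> (forall t, ex_derive f t) ->
  is_RInt f a b (F b - F a).
Proof.
  intros HF Hf. apply (is_RInt_derive F f a b).
  - intros t _. apply HF.
  - intros t _. apply (@ex_derive_continuous R_AbsRing R_NormedModule), Hf.
Qed.

Definition coshcos (x : R) (m : nat) (t : R) : R := cosh (2 * x * t) * cos t ^ m.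

Definition sinhcos (x : R) (m : nat) (t : R) : R :=
  2 * t * sinh (2 * x * t) * cos t ^ m.

Definition coshcos_int (x : R) (m : nat) : R := RInt (coshcos x m) 0 (PI / 2).

Definition sinhcos_int (x : R) (m : nat) : R := RInt (sinhcos x m) 0 (PI / 2).

Lemma ex_derive_coshcos (x : R) (m : nat) (t : R) : ex_derive (coshcos x m) t.
Proof. unfold coshcos. auto_derive. auto. Qed.

Lemma ex_derive_sinhcos (x : R) (m : nat) (t : R) : ex_derive (sinhcos x m) t.
Proof. unfold sinhcos. auto_derive. auto. Qed.

Lemma ex_RInt_derivable (f : R -> R) (a b : R) :
  (forall t, ex_derive f t) -> ex_RInt f a b.
Proof.
  intros Hf. apply (ex_RInt_continuous (V := R_CompleteNormedModule)).
  intros t _. apply (@ex_derive_continuous R_AbsRing R_NormedModule), Hf.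
Qed.

Lemma is_RInt_coshcos (x : R) (m : nat) :
  is_RInt (coshcos x m) 0 (PI / 2) (coshcos_int x m).
Proof.
  apply (RInt_correct (V := R_CompleteNormedModule)), ex_RInt_derivable.
  apply ex_derive_coshcos.
Qed.

Lemma is_RInt_sinhcos (x : R) (m : nat) :
  is_RInt (sinhcos x m) 0 (PI / 2) (sinhcos_int x m).
Proof.
  apply (RInt_correct (V := R_CompleteNormedModule)), ex_RInt_derivable.
  apply ex_derive_sinhcos.
Qed.

Lemma sin_sqr_cos_sqr (t : R) : sin t * sin t = 1 - cos t * cos t.
Proof. generalize (sin2_cos2 t). unfold Rsqr. lra. Qed.

(** Two integrations by parts, packed into one antiderivative [F] that vanishes at both ends: at 0
    because [sinh] and [sin] do, at pi/2 because [cos] does. Eliminating sin^2 leaves only the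
    exponents m and m + 2. *)
Lemma coshcos_int_rec (x : R) (m : nat) :
  (4 * x ^ 2 + (INR m + 2) ^ 2) * coshcos_int x (S (S m))
  = (INR m + 2) * (INR m + 1) * coshcos_int x m.
Proof.
  set (M := INR m + 2).
  set (F t := 2 * x * sinh (2 * x * t) * cos t ^ S (S m)
              + M * cosh (2 * x * t) * cos t ^ S m * sin t).
  set (f t := (4 * x ^ 2 + M ^ 2) * coshcos x (S (S m)) t
              - M * (INR m + 1) * coshcos x m t).
  assert (H1 : is_RInt f 0 (PI / 2) (F (PI / 2) - F 0)).
  { apply is_RInt_antiderivative.
    - intros t. unfold F, f, coshcos. evar_last; [auto_derive; auto|].
      change (match m with 0%nat => 1 | S _ => INR m + 1 end) with (INR (S m)).
      rewrite S_INR. replace (INR m) with (M - 2) by (unfold M; ring). simpl pow.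
      generalize (sin_sqr_cos_sqr t); intros Hs. ring [Hs].
    - intros t. unfold f, coshcos. auto_derive. auto. }
  assert (H2 : is_RInt f 0 (PI / 2)
     ((4 * x ^ 2 + M ^ 2) * coshcos_int x (S (S m))
              - M * (INR m + 1) * coshcos_int x m)).
  { apply (is_RInt_minus (V := R_NormedModule));
      apply (is_RInt_scal (V := R_NormedModule)); apply is_RInt_coshcos. }
  generalize (is_RInt_unique _ _ _ _ H1). rewrite (is_RInt_unique _ _ _ _ H2).
  unfold F. simpl pow. rewrite cos_PI2, sin_0, !Rmult_0_r, sinh_0. intros.
  lra.
Qed.

(** This is the x-derivative of [coshcos_int_rec]. Rather than differentiating under the integral
    sign, the proof differentiates the former antiderivative in x and uses the result as the new
    [F]. *)
Lemma sinhcos_int_rec (x : R) (m : nat) :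
  (4 * x ^ 2 + (INR m + 2) ^ 2) * sinhcos_int x (S (S m))
   + 8 * x * coshcos_int x (S (S m))
  = (INR m + 2) * (INR m + 1) * sinhcos_int x m.
Proof.
  set (M := INR m + 2).
  set (F t := 2 * sinh (2 * x * t) * cos t ^ S (S m)
              + 4 * x * t * cosh (2 * x * t) * cos t ^ S (S m)
              + 2 * t * M * sinh (2 * x * t) * cos t ^ S m * sin t).
  set (f t := (4 * x ^ 2 + M ^ 2) * sinhcos x (S (S m)) t
              + 8 * x * coshcos x (S (S m)) t
              - M * (INR m + 1) * sinhcos x m t).
  assert (H1 : is_RInt f 0 (PI / 2) (F (PI / 2) - F 0)).
  { apply is_RInt_antiderivative.
    - intros t. unfold F, f, coshcos, sinhcos. evar_last; [auto_derive; auto|].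
      change (match m with 0%nat => 1 | S _ => INR m + 1 end) with (INR (S m)).
      rewrite S_INR. replace (INR m) with (M - 2) by (unfold M; ring). simpl pow.
      generalize (sin_sqr_cos_sqr t); intros Hs. ring [Hs].
    - intros t. unfold f, coshcos, sinhcos. auto_derive. auto. }
  assert (H2 : is_RInt f 0 (PI / 2)
     ((4 * x ^ 2 + M ^ 2) * sinhcos_int x (S (S m))
              + 8 * x * coshcos_int x (S (S m))
              - M * (INR m + 1) * sinhcos_int x m)).
  { apply (is_RInt_minus (V := R_NormedModule));
      [apply (is_RInt_plus (V := R_NormedModule))|];
      apply (is_RInt_scal (V := R_NormedModule));
      [apply is_RInt_sinhcos | apply is_RInt_coshcos | apply is_RInt_sinhcos]. }
  generalize (is_RInt_unique _ _ _ _ H1). rewrite (is_RInt_unique _ _ _ _ H2).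
  unfold F. simpl pow. rewrite cos_PI2, sin_0, !Rmult_0_r, sinh_0. intros.
  lra.
Qed.

Lemma coshcos_int_0 (x : R) : 0 < x -> coshcos_int x 0 = sinh (PI * x) / (2 * x).
Proof.
  intros Hx.
  assert (H : is_RInt (coshcos x 0) 0 (PI / 2)
    (sinh (2 * x * (PI / 2)) / (2 * x) - sinh (2 * x * 0) / (2 * x))).
  { apply (is_RInt_antiderivative (fun t => sinh (2 * x * t) / (2 * x))).
    - intros t. unfold coshcos. evar_last; [auto_derive; auto|]. simpl. field. lra.
    - apply ex_derive_coshcos. }
  unfold coshcos_int. rewrite (is_RInt_unique _ _ _ _ H).
  rewrite Rmult_0_r, sinh_0. replace (2 * x * (PI / 2)) with (PI * x) by field.
  field. lra.
Qed.

Lemma sinhcos_int_0 (x : R) : 0 < x ->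
  sinhcos_int x 0 = PI * cosh (PI * x) / (2 * x) - sinh (PI * x) / (2 * x ^ 2).
Proof.
  intros Hx.
  set (F t := t * cosh (2 * x * t) / x - sinh (2 * x * t) / (2 * x ^ 2)).
  assert (H : is_RInt (sinhcos x 0) 0 (PI / 2) (F (PI / 2) - F 0)).
  { apply is_RInt_antiderivative.
    - intros t. unfold F, sinhcos. evar_last; [auto_derive; auto|]. simpl. field. lra.
    - apply ex_derive_sinhcos. }
  unfold sinhcos_int. rewrite (is_RInt_unique _ _ _ _ H). unfold F.
  rewrite !Rmult_0_r, sinh_0. replace (2 * x * (PI / 2)) with (PI * x) by field.
  field. lra.
Qed.

(** * Elementary inequalities and the comparison of the two integrals *)

Lemma cosh_ge_1 (y : R) : 1 <= cosh y.
Proof.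
  unfold cosh. rewrite exp_Ropp. generalize (exp_pos y). intros H.
  set (e := exp y) in *. assert (0 <= (e - 1) ^ 2 / e).
  { apply Rdiv_le_0_compat; [apply pow2_ge_0 | exact H]. }
  replace ((e - 1) ^ 2 / e) with (e + / e - 2) in H0 by (field; lra). lra.
Qed.

Lemma nonneg_derivative_nonneg (f df : R -> R) (b : R) :
  (forall t, is_derive f t (df t)) -> (forall t, ex_derive df t) ->
  f 0 = 0 -> 0 <= b -> (forall t, 0 < t < b -> 0 <= df t) -> 0 <= f b.
Proof.
  intros H1 H2 H3 Hb H.
  replace (f b) with (f b - f 0) by (rewrite H3; ring).
  eapply is_RInt_ge_0; [exact Hb | apply is_RInt_antiderivative; eassumption | exact H].
Qed.

Lemma sinh_nonneg (y : R) : 0 <= y -> 0 <= sinh y.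
Proof.
  intros Hy. apply (nonneg_derivative_nonneg sinh cosh); auto.
  - intros t. auto_derive; auto. ring.
  - intros t. auto_derive. auto.
  - apply sinh_0.
  - intros t _. generalize (cosh_ge_1 t). lra.
Qed.

Lemma sinh_le_mul_cosh (y : R) : 0 <= y -> sinh y <= y * cosh y.
Proof.
  intros Hy.
  cut (0 <= y * cosh y - sinh y); [lra|].
  apply (nonneg_derivative_nonneg (fun y => y * cosh y - sinh y) (fun y => y * sinh y)); auto.
  - intros t. auto_derive; auto. ring.
  - intros t. auto_derive. auto.
  - rewrite sinh_0. ring.
  - intros t Ht. apply Rmult_le_pos; [lra|]. apply sinh_nonneg. lra.
Qed.

Lemma cosh_le (a b : R) : 0 <= a <= b -> cosh a <= cosh b.
Proof.
  intros [Ha Hb].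
  cut (0 <= cosh (a + (b - a)) - cosh a). { replace (a + (b-a)) with b by ring. lra. }
  apply (nonneg_derivative_nonneg (fun y => cosh (a + y) - cosh a) (fun y => sinh (a + y))).
  - intros t. auto_derive; auto. ring.
  - intros t. auto_derive. auto.
  - rewrite Rplus_0_r. ring.
  - lra.
  - intros t Ht. apply sinh_nonneg. lra.
Qed.

Lemma mul_cos_le_sin (t : R) : 0 <= t <= PI / 2 -> t * cos t <= sin t.
Proof.
  intros Ht.
  cut (0 <= sin t - t * cos t); [lra|].
  apply (nonneg_derivative_nonneg (fun y => sin y - y * cos y) (fun y => y * sin y)).
  - intros y. auto_derive; auto. ring.
  - intros y. auto_derive. auto.
  - rewrite sin_0. ring.
  - lra.
  - intros y Hy. apply Rmult_le_pos; [lra|]. apply sin_ge_0; lra.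
Qed.

Lemma sinhcos_int_nonneg (x : R) (m : nat) : 0 < x -> 0 <= sinhcos_int x m.
Proof.
  intros Hx. generalize PI_RGT_0; intros HPI.
  apply (is_RInt_ge_0 (sinhcos x m) 0 (PI / 2)); [lra | apply is_RInt_sinhcos |].
  intros t Ht. unfold sinhcos.
  apply Rmult_le_pos; [apply Rmult_le_pos; [lra|]|].
  - apply sinh_nonneg. repeat apply Rmult_le_pos; lra.
  - apply pow_le, cos_ge_0; lra.
Qed.

(* [t cos t <= sin t] trades the factor [t * sinh] for [sin^2], which gains the factor
   [1 / (m + 1)] upon integration by parts. *)
Lemma sinhcos_int_le (x : R) (m : nat) : 0 < x ->
  (INR m + 1) * sinhcos_int x (S (S m))
  <= 4 * x * cosh (PI * x) * coshcos_int x (S (S m)).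
Proof.
  intros Hx. generalize PI_RGT_0; intros HPI.
  set (K := 4 * x * cosh (PI * x)).
  (* [F] vanishes at both ends and has derivative [f], so the integral of cos^(m+2) equals m + 1
     times that of sin^2 cos^m. *)
  set (F t := sin t * cos t ^ S m).
  set (f t := cos t ^ S (S m) - (INR m + 1) * (sin t * sin t * cos t ^ m)).
  assert (HF : is_RInt f 0 (PI / 2) 0).
  { replace 0 with (F (PI / 2) - F 0) at 2
      by (unfold F; simpl; rewrite cos_PI2, sin_0; ring).
    apply is_RInt_antiderivative; intros t; unfold F, f.
    - evar_last; [auto_derive; auto|]. change (match m with 0%nat => 1 | S _ => INR m + 1 end) with (INR (S m)).
      rewrite S_INR. simpl pow. ring.
    - auto_derive. auto. }
  (* Subtracting [K] times the zero integral of [f] reduces the claim to a pointwise inequality of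
     integrands. *)
  replace (K * coshcos_int x (S (S m))) with (K * coshcos_int x (S (S m)) - K * 0) by ring.
  apply (is_RInt_le (fun t => (INR m + 1) * sinhcos x (S (S m)) t)
           (fun t => K * coshcos x (S (S m)) t - K * f t) 0 (PI / 2)).
  - lra.
  - apply (is_RInt_scal (V := R_NormedModule)), is_RInt_sinhcos.
  - apply (is_RInt_minus (V := R_NormedModule));
      apply (is_RInt_scal (V := R_NormedModule)); [apply is_RInt_coshcos | exact HF].
  - intros t Ht.
    assert (Hc : 0 <= cos t) by (apply cos_ge_0; lra).
    assert (Hp : 0 <= cos t ^ m) by (apply pow_le; exact Hc).
    assert (Hm : 0 <= INR m) by apply pos_INR.
    assert (Hs : 0 <= t * cos t <= sin t).
    { split; [apply Rmult_le_pos; lra | apply mul_cos_le_sin; lra]. }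
    assert (Hxt : 0 <= x * t) by (apply Rmult_le_pos; lra).
    assert (Hch : cosh (2 * x * t) <= cosh (PI * x)).
    { apply cosh_le. split; [nra|]. replace (PI * x) with (2 * x * (PI / 2)) by field.
      apply Rmult_le_compat_l; lra. }
    assert (Hsh : 2 * t * sinh (2 * x * t) <= K * t ^ 2).
    { replace (K * t ^ 2) with (2 * t * ((2 * x * t) * cosh (PI * x)))
        by (unfold K; ring).
      apply Rmult_le_compat_l; [lra|].
      apply Rle_trans with ((2 * x * t) * cosh (2 * x * t)).
      - apply sinh_le_mul_cosh. nra.
      - apply Rmult_le_compat_l; [nra | exact Hch]. }
    assert (HK : 0 <= K).
    { unfold K. generalize (cosh_ge_1 (PI * x)). nra. }
    (* Since cosh >= 1, the [coshcos] term absorbs the cos^(m+2) part of [f]; what remains is the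
       sin^2 part, treated in [Hu]. *)
    assert (Hq : 0 <= K * cos t ^ S (S m) * (cosh (2 * x * t) - 1)).
    { apply Rmult_le_pos; [apply Rmult_le_pos; [exact HK | apply pow_le; exact Hc]|].
      generalize (cosh_ge_1 (2 * x * t)). lra. }
    assert (Hsq : (t * cos t) * (t * cos t) <= sin t * sin t)
      by (apply Rmult_le_compat; lra).
    assert (Hu : 2 * t * sinh (2 * x * t) * cos t ^ S (S m)
                 <= K * (sin t * sin t) * cos t ^ m).
    { apply Rle_trans with (K * t ^ 2 * cos t ^ S (S m)).
      - apply Rmult_le_compat_r; [apply pow_le; exact Hc | exact Hsh].
      - replace (K * t ^ 2 * cos t ^ S (S m))
          with (K * (t * cos t * (t * cos t)) * cos t ^ m) by (simpl; ring).
        apply Rmult_le_compat_r; [exact Hp|]. apply Rmult_le_compat_l; assumption. }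
    apply (Rmult_le_compat_l (INR m + 1)) in Hu; [|lra].
    unfold coshcos, sinhcos, f. nra.
Qed.

(** * Partial fractions of coth *)

Lemma coshcos_int_pos (x : R) (k : nat) : 0 < x -> 0 < coshcos_int x (2 * k).
Proof.
  intros Hx. induction k as [|k IH].
  - simpl. rewrite coshcos_int_0 by exact Hx.
    apply Rdiv_lt_0_compat; [|lra]. rewrite <- sinh_0. apply sinh_lt.
    apply Rmult_lt_0_compat; [apply PI_RGT_0 | exact Hx].
  - replace (2 * S k)%nat with (S (S (2 * k))) by lia.
    assert (Hm : 0 <= INR (2 * k)) by apply pos_INR.
    generalize (coshcos_int_rec x (2 * k)). intros E.
    assert (0 < 4 * x ^ 2 + (INR (2 * k) + 2) ^ 2) by nra.
    apply (Rmult_lt_reg_l (4 * x ^ 2 + (INR (2 * k) + 2) ^ 2)); [assumption|].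
    rewrite E, Rmult_0_r. repeat apply Rmult_lt_0_compat; lra.
Qed.

(** This is the logarithmic derivative in x of [coshcos_int x (2 * k)]. Each step of the recurrence
    divides that integral by 4 ((k+1)^2 + x^2), up to a factor free of x, which explains the
    difference found in [coth_ratio_S]. *)
Definition coth_ratio (x : R) (k : nat) : R :=
  sinhcos_int x (2 * k) / coshcos_int x (2 * k).

Lemma coth_ratio_S (x : R) (k : nat) : 0 < x ->
  coth_ratio x k - coth_ratio x (S k) = 2 * x * / (INR (S k) ^ 2 + x ^ 2).
Proof.
  intros Hx. unfold coth_ratio.
  generalize (coshcos_int_pos x k Hx) (coshcos_int_pos x (S k) Hx)
    (coshcos_int_rec x (2 * k)) (sinhcos_int_rec x (2 * k)).
  replace (2 * S k)%nat with (S (S (2 * k))) by lia.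
  assert (Hm : 0 <= INR k) by apply pos_INR.
  replace (INR (2 * k)) with (2 * INR k) by (rewrite mult_INR; simpl; ring).
  rewrite S_INR.
  set (I := coshcos_int x (2 * k)). set (I' := coshcos_int x (S (S (2 * k)))).
  set (J := sinhcos_int x (2 * k)). set (J' := sinhcos_int x (S (S (2 * k)))).
  intros HI HI' E1 E2.
  set (A := (2 * INR k + 2) * (2 * INR k + 1)) in *.
  assert (HA : 0 < A) by (unfold A; nra).
  assert (HD : 0 < (INR k + 1) ^ 2 + x ^ 2) by nra.
  replace J with (((4 * x ^ 2 + (2 * INR k + 2) ^ 2) * J' + 8 * x * I') / A)
    by (rewrite E2; field; lra).
  replace I with (((4 * x ^ 2 + (2 * INR k + 2) ^ 2) * I') / A)
    by (rewrite E1; field; lra).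
  field. repeat split; nra.
Qed.

(** The hyperbolic cotangent is written as 1 + 2 / (exp (2 pi x) - 1) to match the denominators in
    [S3]. *)
Lemma coth_ratio_0 (x : R) : 0 < x ->
  coth_ratio x 0 = PI * (1 + 2 / (exp (2 * PI * x) - 1)) - 1 / x.
Proof.
  intros Hx. unfold coth_ratio. simpl. rewrite coshcos_int_0, sinhcos_int_0 by exact Hx.
  unfold cosh, sinh. rewrite exp_Ropp.
  replace (2 * PI * x) with (PI * x + PI * x) by ring. rewrite exp_plus.
  assert (H : 1 < exp (PI * x)).
  { rewrite <- exp_0. apply exp_increasing, Rmult_lt_0_compat; [apply PI_RGT_0 | exact Hx]. }
  set (e := exp (PI * x)) in *. field. repeat split; nra.
Qed.

Lemma coth_ratio_lim (x : R) : 0 < x -> is_lim_seq (coth_ratio x) 0.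
Proof.
  intros Hx. apply is_lim_seq_incr_1.
  set (K := 4 * x * cosh (PI * x)).
  assert (HK : 0 <= K) by (unfold K; generalize (cosh_ge_1 (PI * x)); nra).
  (* [sinhcos_int_le] at exponent 2k + 2 bounds the ratio by K / (2k + 1), hence by K / (k + 1). It
     says nothing about exponent 0, whence the shift of the sequence by one. *)
  apply (is_lim_seq_le_le (fun _ => 0) _ (fun k => K * / INR (S k))).
  - intros k. unfold coth_ratio.
    generalize (coshcos_int_pos x (S k) Hx).
    replace (2 * S k)%nat with (S (S (2 * k))) by lia.
    intros HI. split.
    + apply Rdiv_le_0_compat; [apply sinhcos_int_nonneg; exact Hx | exact HI].
    + generalize (sinhcos_int_le x (2 * k) Hx) (sinhcos_int_nonneg x (S (S (2 * k))) Hx).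
      fold K. intros HJ HJ0.
      assert (Hm : 0 <= INR k) by apply pos_INR.
      replace (INR (2 * k)) with (2 * INR k) in HJ by (rewrite mult_INR; simpl; ring).
      rewrite S_INR.
      apply Rle_div_l; [exact HI|].
      apply (Rmult_le_reg_l (INR k + 1)); [lra|].
      replace ((INR k + 1) * (K * / (INR k + 1) * coshcos_int x (S (S (2 * k)))))
        with (K * coshcos_int x (S (S (2 * k)))) by (field; lra).
      nra.
  - apply is_lim_seq_const.
  - replace (Finite 0) with (Rbar_mult K 0) by (simpl; f_equal; ring).
    apply is_lim_seq_scal_l.
    replace (Finite 0) with (Rbar_inv p_infty) by reflexivity.
    apply is_lim_seq_inv; [|discriminate].
    apply (proj1 (is_lim_seq_incr_1 INR p_infty)), is_lim_seq_INR.
Qed.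

Lemma is_series_telescope (u : nat -> R) :
  is_lim_seq u 0 -> is_series (fun k => u k - u (S k)) (u 0%nat).
Proof.
  intros H. change (is_lim_seq (sum_n (fun k => u k - u (S k))) (u 0%nat)).
  apply (is_lim_seq_ext (fun n => u 0%nat - u (S n))).
  - intros n. induction n as [|n IH]; [now rewrite sum_O|].
    rewrite sum_Sn, <- IH. unfold plus; simpl. ring.
  - replace (Finite (u 0%nat)) with (Finite (u 0%nat - 0)) by (f_equal; ring).
    apply is_lim_seq_minus'; [apply is_lim_seq_const|].
    now apply (proj1 (is_lim_seq_incr_1 u 0)).
Qed.

Lemma is_series_mult_l (c : R) (a : nat -> R) (l : R) :
  is_series a l -> is_series (fun n => c * a n) (c * l).
Proof. apply (is_series_scal_l (V := R_NormedModule)). Qed.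

(** The differences of [coth_ratio] telescope to its initial value; dividing by 2x gives the
    series. *)
Lemma is_series_coth (x : R) : 0 < x ->
  is_series (fun m => / (INR (S m) ^ 2 + x ^ 2))
    ((PI * x * (1 + 2 / (exp (2 * PI * x) - 1)) - 1) / (2 * x ^ 2)).
Proof.
  intros Hx.
  generalize (is_series_mult_l (/ (2 * x)) _ _ (is_series_telescope _ (coth_ratio_lim x Hx))).
  rewrite coth_ratio_0 by exact Hx. intros H.
  assert (0 < exp (2 * PI * x) - 1).
  { cut (1 < exp (2 * PI * x)); [lra|]. rewrite <- exp_0. apply exp_increasing.
    generalize PI_RGT_0; intros. nra. }
  match type of H with is_series _ ?l => match goal with |- is_series _ ?r =>
    replace r with l by (field; lra) end end.
  revert H. apply is_series_ext. intros k. rewrite coth_ratio_S by exact Hx.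
  match goal with |- ?a = ?b => change (@eq R a b) end.
  field. generalize (pos_INR (S k)); nra.
Qed.

(** * The values of zeta(2) and zeta(4) *)

Lemma is_series_add (a b : nat -> R) (la lb : R) :
  is_series a la -> is_series b lb -> is_series (fun n => a n + b n) (la + lb).
Proof. apply (is_series_plus (V := R_NormedModule)). Qed.

Lemma is_series_le (a b : nat -> R) (la lb : R) :
  (forall n, a n <= b n) -> is_series a la -> is_series b lb -> la <= lb.
Proof.
  intros H Ha Hb. apply (is_lim_seq_le (sum_n a) (sum_n b) la lb); [|exact Ha|exact Hb].
  intros n. apply sum_n_m_le, H.
Qed.

(** Comparison with the coth series at x = 1, which is already known to converge: p^(2+j) >= p^2 >=
    (p^2 + 1) / 2 for p >= 1. *)
Lemma ex_series_inv_pow (j : nat) : ex_series (fun k => / INR (S k) ^ (2 + j)).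
Proof.
  apply (ex_series_le (V := R_CompleteNormedModule)) with (fun k => 2 * / (INR (S k) ^ 2 + 1 ^ 2)).
  - intros k. change (Rabs (/ INR (S k) ^ (2 + j)) <= 2 * / (INR (S k) ^ 2 + 1 ^ 2)).
    assert (Hk : 1 <= INR (S k)) by (rewrite S_INR; generalize (pos_INR k); lra).
    set (p := INR (S k)) in *.
    assert (Hj : 1 <= p ^ j) by (apply pow_R1_Rle; exact Hk).
    assert (H2 : p ^ 2 <= p ^ (2 + j)) by (rewrite pow_add; nra).
    rewrite Rabs_pos_eq by (left; apply Rinv_0_lt_compat; nra).
    replace (2 * / (p ^ 2 + 1 ^ 2)) with (/ ((p ^ 2 + 1) / 2)) by (field; nra).
    apply Rinv_le_contravar; nra.
  - eexists. apply is_series_mult_l, is_series_coth. lra.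
Qed.

(** The Lagrange remainder is z^7 exp(c) / 7! with c below 1, and exp(c) <= 3. Order 6 is what the
    cancellation in [coth_series_expansion] consumes. *)
Lemma exp_taylor_6 (z : R) : 0 < z <= 1 -> exists r, 0 <= r <= 1 /\
  exp z = 1 + z + z ^ 2 / 2 + z ^ 3 / 6 + z ^ 4 / 24 + z ^ 5 / 120 + z ^ 6 / 720 + z ^ 7 * r.
Proof.
  intros [Hz Hz1].
  assert (HD : forall n y, Derive_n exp n y = exp y)
    by (intros n y; apply is_derive_n_unique, is_derive_n_exp).
  destruct (Taylor_Lagrange exp 6 0 z Hz) as [c [Hc E]].
  { intros t _ [|k] _; [exact I|]. apply (ex_derive_ext exp).
    - intros y. symmetry. apply HD.
    - auto_derive. auto. }
  exists (exp c / 5040). split.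
  - assert (Hc1 : exp c <= exp 1) by (left; apply exp_increasing; lra).
    generalize exp_le_3 (exp_pos c). lra.
  - rewrite E. rewrite HD. replace (INR (Factorial.fact 7)) with 5040 by (rewrite INR_IZR_INZ; reflexivity).
    unfold sum_f_R0. rewrite !HD, exp_0, Rminus_0_r. simpl. field.
Qed.

(** With z = 2 pi x this is (z/2) coth(z/2) = 1 + z^2/12 - z^4/720 + O(z^6), after subtracting 1 and
    dividing by 2 x^2. Multiplying by e - 1 clears the denominator and leaves the numerator [N]. *)
Lemma coth_series_expansion (x : R) : 0 < x -> 2 * PI * x <= 1 ->
  Rabs ((PI * x * (1 + 2 / (exp (2 * PI * x) - 1)) - 1) / (2 * x ^ 2)
        - (PI ^ 2 / 6 - x ^ 2 * (PI ^ 4 / 90))) <= (2 * PI) ^ 6 * x ^ 4.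
Proof.
  intros Hx Hz1. generalize PI_RGT_0; intros HPI.
  set (z := 2 * PI * x) in *.
  assert (Hz : 0 < z) by (unfold z; apply Rmult_lt_0_compat; lra).
  destruct (exp_taylor_6 z (conj Hz Hz1)) as [r [Hr E]].
  set (e := exp z) in *.
  set (N := z / 2 * (e + 1) - (1 + z ^ 2 / 12 - z ^ 4 / 720) * (e - 1)).
  (* All powers of z below the seventh cancel; this is where the coefficients 1/12 and -1/720 are
     verified. *)
  assert (HN : N = z ^ 7 * (1 / 4320 - z / 17280 + z ^ 2 / 86400 + z ^ 3 / 518400
                     + r * (z / 2 - 1 - z ^ 2 / 12 + z ^ 4 / 720)))
    by (unfold N; rewrite E; field).
  assert (Hz2 : 0 <= z ^ 2 <= 1) by (split; [apply pow_le | rewrite <- (pow1 2); apply pow_incr]; lra).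
  assert (Hz3 : 0 <= z ^ 3 <= 1) by (split; [apply pow_le | rewrite <- (pow1 3); apply pow_incr]; lra).
  assert (Hz4 : 0 <= z ^ 4 <= 1) by (split; [apply pow_le | rewrite <- (pow1 4); apply pow_incr]; lra).
  assert (Hz7 : 0 <= z ^ 7) by (apply pow_le; lra).
  assert (HNb : Rabs N <= 2 * z ^ 7).
  { rewrite HN, Rabs_mult, (Rabs_pos_eq (z ^ 7)), (Rmult_comm 2) by exact Hz7.
    apply Rmult_le_compat_l; [exact Hz7|]. apply Rabs_le. split; nra. }
  (* Dividing by e - 1 >= z costs one power of z, so the error is at most 2 z^6 / (2 x^2) = (2 pi)^6
     x^4. *)
  assert (He : z <= e - 1).
  { assert (0 <= z ^ 5) by (apply pow_le; lra).
    assert (0 <= z ^ 6) by (apply pow_le; lra).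
    assert (0 <= z ^ 7 * r) by (apply Rmult_le_pos; lra). lra. }
  assert (Hd : 0 < (e - 1) * (2 * x ^ 2)).
  { apply Rmult_lt_0_compat; [lra|]. generalize (pow_lt x 2 Hx). lra. }
  replace (_ - _) with (N / ((e - 1) * (2 * x ^ 2))).
  2:{ unfold N, z. field. split; [|lra]. fold z. lra. }
  rewrite Rabs_div by lra.
  rewrite (Rabs_pos_eq ((e - 1) * (2 * x ^ 2))) by lra.
  apply Rle_div_l; [exact Hd|]. apply Rle_trans with (1 := HNb).
  replace ((2 * PI) ^ 6 * x ^ 4 * ((e - 1) * (2 * x ^ 2))) with (2 * (z ^ 6 * (e - 1)))
    by (unfold z; ring).
  apply Rmult_le_compat_l; [lra|].
  replace (z ^ 7) with (z ^ 6 * z) by ring.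
  apply Rmult_le_compat_l; [apply pow_le; lra | exact He].
Qed.

Lemma eq_0_of_small_bound (a K d : R) : 0 < d ->
  (forall x, 0 < x <= d -> Rabs a <= K * x) -> a = 0.
Proof.
  intros Hd H. destruct (Req_dec a 0) as [|Ha]; [assumption|exfalso].
  apply Rabs_pos_lt in Ha.
  assert (HK : 0 < K) by (generalize (H d (conj Hd (Rle_refl d))); nra).
  set (x := Rmin d (Rabs a / (2 * K))).
  assert (Hx : 0 < x) by (apply Rmin_pos; [|apply Rdiv_lt_0_compat]; lra).
  generalize (H x (conj Hx (Rmin_l _ _))).
  assert (K * x <= K * (Rabs a / (2 * K))) by (apply Rmult_le_compat_l; [lra | apply Rmin_r]).
  replace (K * (Rabs a / (2 * K))) with (Rabs a / 2) in * by (field; lra). lra.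
Qed.

(** Comparison of coefficients: the bound first forces |a| = O(x), so a = 0; dividing by x^2 then
    gives |b| = O(x^2), so b = 0. *)
Lemma quadratic_zero_of_quartic_bound (a b K d : R) : 0 < d <= 1 -> 0 <= K ->
  (forall x, 0 < x <= d -> Rabs (a - x ^ 2 * b) <= K * x ^ 4) -> a = 0 /\ b = 0.
Proof.
  intros Hd HK H.
  assert (Ha : a = 0).
  { apply (eq_0_of_small_bound a (K + Rabs b) d); [lra|]. intros x Hx.
    replace a with ((a - x ^ 2 * b) + x ^ 2 * b) at 1 by ring.
    apply Rle_trans with (1 := Rabs_triang _ _). rewrite Rabs_mult.
    rewrite (Rabs_pos_eq (x ^ 2)) by (apply pow_le; lra).
    generalize (H x Hx) (Rabs_pos b).
    assert (0 <= x ^ 2 <= x) by nra.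
    assert (0 <= x ^ 4 <= x).
    { replace (x ^ 4) with (x ^ 2 * x ^ 2) by ring. nra. }
    intros. nra. }
  split; [exact Ha|]. subst a.
  apply (eq_0_of_small_bound b K d); [lra|]. intros x Hx.
  generalize (H x Hx). rewrite Rminus_0_l, Rabs_Ropp, Rabs_mult.
  rewrite (Rabs_pos_eq (x ^ 2)) by (apply pow_le; lra).
  assert (0 < x ^ 2 <= x) by nra.
  intros Hb. apply (Rmult_le_reg_l (x ^ 2)); [lra|]. apply Rle_trans with (1 := Hb).
  replace (K * x ^ 4) with (x ^ 2 * (K * x ^ 2)) by ring.
  apply Rmult_le_compat_l; [lra|]. apply Rmult_le_compat_l; lra.
Qed.

Lemma sum_n_incr (a : nat -> R) (n m : nat) :
  (forall k, 0 <= a k) -> (n <= m)%nat -> sum_n a n <= sum_n a m.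
Proof.
  intros Ha H. induction H as [|m _ IH]; [lra|].
  rewrite sum_Sn. generalize (Ha (S m)). unfold plus; simpl. lra.
Qed.

Lemma sum_n_le_series (a : nat -> R) (l : R) (n : nat) :
  (forall k, 0 <= a k) -> is_series a l -> sum_n a n <= l.
Proof.
  intros Ha H. apply (is_lim_seq_incr_compare (sum_n a)); [exact H|].
  intros m. apply sum_n_incr; [exact Ha | lia].
Qed.

Lemma is_series_nonneg (a : nat -> R) (l : R) :
  (forall k, 0 <= a k) -> is_series a l -> 0 <= l.
Proof.
  intros Ha H. apply Rle_trans with (sum_n a 0).
  - rewrite sum_O. apply Ha.
  - now apply sum_n_le_series.
Qed.

Lemma zeta_2_4_values :
  Series (fun k => / INR (S k) ^ 2) = PI ^ 2 / 6 /\
  Series (fun k => / INR (S k) ^ 4) = PI ^ 4 / 90.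
Proof.
  assert (H2 := Series_correct _ (ex_series_inv_pow 0)).
  assert (H4 := Series_correct _ (ex_series_inv_pow 2)).
  simpl Nat.add in H2, H4.
  set (Z2 := Series (fun k => / INR (S k) ^ 2)) in *.
  set (Z4 := Series (fun k => / INR (S k) ^ 4)) in *.
  generalize PI_RGT_0; intros HPI.
  assert (HZ4 : 0 <= Z4).
  { apply (is_series_nonneg (fun k => / INR (S k) ^ 4)); [|exact H4].
    intros k. left. apply Rinv_0_lt_compat, pow_lt, lt_0_INR. lia. }
  (* The coth series [T] is expanded in two ways, termwise and through exp. The constant adds the
     two errors, Z4 x^4 and (2 pi)^6 x^4, and x <= 1 / (2 pi) is the range z <= 1 of the second
     expansion. *)
  destruct (quadratic_zero_of_quartic_bound (Z2 - PI ^ 2 / 6) (Z4 - PI ^ 4 / 90)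
    (Z4 + (2 * PI) ^ 6) (/ (2 * PI))) as [E2 E4].
  - split; [apply Rinv_0_lt_compat; lra|]. rewrite <- Rinv_1.
    apply Rinv_le_contravar; generalize PI2_1; lra.
  - generalize (pow_le (2 * PI) 6). lra.
  - intros x [Hx Hxd].
    assert (Hz : 2 * PI * x <= 1).
    { apply (Rmult_le_compat_l (2 * PI)) in Hxd; [|lra]. rewrite Rinv_r in Hxd; lra. }
    generalize (coth_series_expansion x Hx Hz) (is_series_coth x Hx).
    set (T := _ / (2 * x ^ 2)). intros HT HTs.
    (* Termwise, 1/(p^2 + x^2) - 1/p^2 + x^2/p^4 = x^4 / (p^4 (p^2 + x^2)), which lies between 0 and
       x^4 / p^4. *)
    assert (HD : 0 <= T + (-1 * Z2 + x ^ 2 * Z4) <= x ^ 4 * Z4).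
    { assert (Hs : is_series (fun k => / (INR (S k) ^ 2 + x ^ 2)
          + (-1 * / INR (S k) ^ 2 + x ^ 2 * / INR (S k) ^ 4)) (T + (-1 * Z2 + x ^ 2 * Z4))).
      { apply is_series_add; [exact HTs|].
        apply is_series_add; apply is_series_mult_l; assumption. }
      assert (Hp : forall k, 0 <= / (INR (S k) ^ 2 + x ^ 2)
          + (-1 * / INR (S k) ^ 2 + x ^ 2 * / INR (S k) ^ 4) <= x ^ 4 * / INR (S k) ^ 4).
      { intros k. assert (Hk : 1 <= INR (S k)) by (rewrite S_INR; generalize (pos_INR k); lra).
        set (p := INR (S k)) in *.
        assert (1 <= p ^ 2 + x ^ 2) by nra.
        replace (/ (p ^ 2 + x ^ 2) + (-1 * / p ^ 2 + x ^ 2 * / p ^ 4))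
          with (x ^ 4 * / p ^ 4 * / (p ^ 2 + x ^ 2)) by (field; lra).
        assert (0 < x ^ 4 * / p ^ 4).
        { apply Rmult_lt_0_compat; [apply pow_lt; lra|]. apply Rinv_0_lt_compat, pow_lt. lra. }
        assert (0 < / (p ^ 2 + x ^ 2) <= 1).
        { split; [apply Rinv_0_lt_compat; lra|]. rewrite <- Rinv_1. apply Rinv_le_contravar; lra. }
        nra. }
      split.
      - apply (is_series_nonneg _ _ (fun k => proj1 (Hp k)) Hs).
      - apply (is_series_le _ _ _ _ (fun k => proj2 (Hp k)) Hs).
        apply is_series_mult_l, H4. }
    replace (Z2 - PI ^ 2 / 6 - x ^ 2 * (Z4 - PI ^ 4 / 90))
      with (T - (PI ^ 2 / 6 - x ^ 2 * (PI ^ 4 / 90)) - (T + (-1 * Z2 + x ^ 2 * Z4))) by ring.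
    apply Rle_trans with (1 := Rabs_triang _ _). rewrite Rabs_Ropp, (Rabs_pos_eq _ (proj1 HD)).
    lra.
  - lra.
Qed.

(** * Square partial sums of double series *)

Lemma is_lim_seq_sum_n (u : nat -> nat -> R) (r : nat -> R) (K : nat) :
  (forall n, is_lim_seq (u n) (r n)) ->
  is_lim_seq (fun N => sum_n (fun n => u n N) K) (sum_n r K).
Proof.
  intros H. induction K as [|K IH].
  - rewrite sum_O. apply (is_lim_seq_ext (u 0%nat)); [|apply H].
    intros N. now rewrite sum_O.
  - rewrite sum_Sn.
    apply (is_lim_seq_ext (fun N => sum_n (fun n => u n N) K + u (S K) N)).
    + intros N. now rewrite sum_Sn.
    + apply (is_lim_seq_plus' _ _ _ _ IH (H (S K))).
Qed.

(** Square sums are symmetric in the two indices, so the later exchange of summations concerns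
    finite sums only. By nonnegativity they stay below l; from below, K rows nearly exhaust l, and a
    large square nearly exhausts those K rows. *)
Lemma is_lim_seq_square_sums (a : nat -> nat -> R) (r : nat -> R) (l : R) :
  (forall n m, 0 <= a n m) -> (forall n, is_series (a n) (r n)) -> is_series r l ->
  is_lim_seq (fun N => sum_n (fun n => sum_n (a n) N) N) l.
Proof.
  intros Ha Hr Hl.
  assert (Hr0 : forall n, 0 <= r n).
  { intros n. now apply (is_series_nonneg (a n)). }
  apply is_lim_seq_spec. intros eps.
  destruct (proj2 (is_lim_seq_spec (sum_n r) l) Hl (pos_div_2 eps)) as [K HK].
  specialize (HK K (Nat.le_refl K)).
  destruct (proj2 (is_lim_seq_spec _ _)
    (is_lim_seq_sum_n (fun n => sum_n (a n)) r K Hr) (pos_div_2 eps)) as [M HM].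
  exists (Nat.max K M). intros N HN.
  specialize (HM N ltac:(lia)). simpl in HK, HM.
  apply Rabs_def2 in HK. apply Rabs_def2 in HM.
  assert (sum_n (fun n => sum_n (a n) N) N <= sum_n r N).
  { apply sum_n_m_le. intros n. now apply sum_n_le_series. }
  assert (sum_n r N <= l) by now apply sum_n_le_series.
  assert (sum_n (fun n => sum_n (a n) N) K <= sum_n (fun n => sum_n (a n) N) N).
  { apply sum_n_incr; [|lia]. intros n. apply Rle_trans with (sum_n (a n) 0).
    - rewrite sum_O. apply Ha.
    - apply sum_n_incr; [apply Ha | lia]. }
  apply Rabs_def1; lra.
Qed.

(** * The lattice sums and the relation between t and 1/t *)

Lemma is_series_S3 (x : R) : 0 < x ->
  is_series (fun n => / (INR (S n) ^ 3 * (exp (x * INR (S n)) - 1))) (S3 x).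
Proof.
  intros Hx. apply Series_correct.
  (* From exp(y) - 1 >= y with y = x p, each term is at most 1 / (x p^4). *)
  apply (ex_series_le (V := R_CompleteNormedModule)) with (fun k => / x * / INR (S k) ^ (2 + 2)).
  - intros k.
    change (Rabs (/ (INR (S k) ^ 3 * (exp (x * INR (S k)) - 1))) <= / x * / INR (S k) ^ 4).
    assert (Hk : 1 <= INR (S k)) by (rewrite S_INR; generalize (pos_INR k); lra).
    set (p := INR (S k)) in *.
    assert (Hxp : 0 < x * p) by nra.
    generalize (exp_ineq1_le (x * p)); intros He.
    assert (Hp : 0 < p ^ 3) by (apply pow_lt; lra).
    rewrite Rabs_pos_eq by (left; apply Rinv_0_lt_compat; nra).
    rewrite <- Rinv_mult. apply Rinv_le_contravar.
    + apply Rmult_lt_0_compat; [exact Hx | apply pow_lt; lra].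
    + replace (x * p ^ 4) with (p ^ 3 * (x * p)) by ring.
      apply Rmult_le_compat_l; lra.
  - eexists. apply is_series_mult_l, Series_correct, ex_series_inv_pow.
Qed.

Lemma is_series_zeta_3 : is_series (fun n => / INR (S n) ^ 3) (zeta 3).
Proof.
  assert (E : zeta 3 = Series (fun n => / INR (S n) ^ 3)).
  { apply Series_ext. intros n. f_equal. replace 3 with (INR 3) by (simpl; ring).
    apply Rpower_pow, lt_0_INR. lia. }
  rewrite E. apply Series_correct, (ex_series_inv_pow 1).
Qed.

Definition lattice_term (t : R) (n m : nat) : R :=
  / (INR (S n) ^ 2 * (INR (S m) ^ 2 + t ^ 2 * INR (S n) ^ 2)).

(** Row p is the coth series at x = t p divided by p^2. Its sum splits into a 1/p^3 term, an [S3]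
    term and a 1/p^4 term; summing over p gives zeta(3), [S3] and zeta(4). *)
Lemma lattice_square_sums_lim (t : R) : 0 < t ->
  is_lim_seq (fun N => sum_n (fun n => sum_n (lattice_term t n) N) N)
    (PI / (2 * t) * (zeta 3 + 2 * S3 (2 * PI * t)) - PI ^ 4 / 90 / (2 * t ^ 2)).
Proof.
  intros Ht. generalize PI_RGT_0; intros HPI.
  assert (H4 := Series_correct _ (ex_series_inv_pow 2)).
  simpl Nat.add in H4. rewrite (proj2 zeta_2_4_values) in H4.
  assert (Hpos : forall n, 0 < INR (S n)) by (intros n; apply lt_0_INR; lia).
  apply is_lim_seq_square_sums with (r := fun n =>
    PI / (2 * t) * (/ INR (S n) ^ 3 + 2 * / (INR (S n) ^ 3 * (exp (2 * PI * t * INR (S n)) - 1)))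
    + - / (2 * t ^ 2) * / INR (S n) ^ 4).
  - intros n m. left. apply Rinv_0_lt_compat.
    generalize (Hpos n) (Hpos m). intros.
    apply Rmult_lt_0_compat; [apply pow_lt; assumption|].
    assert (0 < INR (S m) ^ 2) by (apply pow_lt; assumption).
    assert (0 <= t ^ 2 * INR (S n) ^ 2) by (apply Rmult_le_pos; apply pow2_ge_0). lra.
  - intros n. generalize (Hpos n); intros Hn.
    assert (Htn : 0 < t * INR (S n)) by (apply Rmult_lt_0_compat; assumption).
    generalize (is_series_mult_l (/ INR (S n) ^ 2) _ _ (is_series_coth _ Htn)).
    replace (2 * PI * (t * INR (S n))) with (2 * PI * t * INR (S n)) by ring.
    assert (He : 0 < exp (2 * PI * t * INR (S n)) - 1).
    { assert (H := Rmult_lt_0_compat _ _ HPI Htn).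
      generalize (exp_ineq1_le (2 * PI * t * INR (S n))). lra. }
    set (e := exp _) in *. set (p := INR (S n)) in *. intros H.
    match type of H with is_series _ ?l => match goal with |- is_series _ ?r =>
      replace r with l by (field; lra) end end.
    revert H. apply is_series_ext. intros m. unfold lattice_term. fold p.
    rewrite <- Rinv_mult. rewrite Rpow_mult_distr. reflexivity.
  - replace (_ - _) with (PI / (2 * t) * (zeta 3 + 2 * S3 (2 * PI * t))
      + - / (2 * t ^ 2) * (PI ^ 4 / 90)) by (field; lra).
    apply is_series_add; apply is_series_mult_l; [|exact H4].
    apply is_series_add; [apply is_series_zeta_3|]. apply is_series_mult_l, is_series_S3.
    generalize (Rmult_lt_0_compat _ _ HPI Ht). lra.
Qed.

Lemma lattice_term_add_swap (t : R) (n m : nat) : 0 < t ->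
  lattice_term t n m + lattice_term (/ t) m n = / INR (S n) ^ 2 * / INR (S m) ^ 2.
Proof.
  intros Ht. unfold lattice_term.
  assert (Hn : 0 < INR (S n)) by (apply lt_0_INR; lia).
  assert (Hm : 0 < INR (S m)) by (apply lt_0_INR; lia).
  set (p := INR (S n)) in *. set (q := INR (S m)) in *.
  field. assert (0 < q ^ 2 + t ^ 2 * p ^ 2) by nra. repeat split; nra.
Qed.

Lemma lattice_square_sums_add (t : R) (N : nat) : 0 < t ->
  sum_n (fun n => sum_n (lattice_term t n) N) N
  + sum_n (fun n => sum_n (lattice_term (/ t) n) N) N
  = sum_n (fun n => / INR (S n) ^ 2) N * sum_n (fun n => / INR (S n) ^ 2) N.
Proof.
  intros Ht. rewrite (sum_n_switch (lattice_term (/ t))).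
  etransitivity; [symmetry; apply (sum_n_plus (G := R_AbelianMonoid))|].
  etransitivity; [|apply (sum_n_mult_r (K := R_Ring))].
  apply sum_n_ext. intros n.
  etransitivity; [symmetry; apply (sum_n_plus (G := R_AbelianMonoid))|].
  etransitivity; [|apply (sum_n_mult_l (K := R_Ring))].
  apply sum_n_ext. intros m. now apply lattice_term_add_swap.
Qed.

(** Ramanujan's formula for zeta(3) with alpha = pi t and beta = pi / t, so that alpha beta = pi^2.
    Both sides are the limit of the same square sums. *)
Lemma zeta_3_ramanujan (t : R) : 0 < t ->
  (PI / (2 * t) * (zeta 3 + 2 * S3 (2 * PI * t)) - PI ^ 4 / 90 / (2 * t ^ 2))
  + (PI / (2 * / t) * (zeta 3 + 2 * S3 (2 * PI * / t)) - PI ^ 4 / 90 / (2 * (/ t) ^ 2))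
  = PI ^ 2 / 6 * (PI ^ 2 / 6).
Proof.
  intros Ht.
  assert (H2 := Series_correct _ (ex_series_inv_pow 0)).
  simpl Nat.add in H2. rewrite (proj1 zeta_2_4_values) in H2.
  assert (H := is_lim_seq_plus' _ _ _ _ (lattice_square_sums_lim t Ht)
    (lattice_square_sums_lim (/ t) (Rinv_0_lt_compat t Ht))).
  set (q := sum_n (fun n => / INR (S n) ^ 2)).
  assert (H' : is_lim_seq (fun N => q N * q N) (PI ^ 2 / 6 * (PI ^ 2 / 6)))
    by (apply is_lim_seq_mult'; exact H2).
  apply (is_lim_seq_ext _ _ _ (fun N => lattice_square_sums_add t N Ht)) in H.
  apply (is_lim_seq_unique (fun N => q N * q N)) in H.
  rewrite (is_lim_seq_unique _ _ H') in H. injection H. auto.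
Qed.

Theorem theorem9 :
  zeta 3 = 5 * PI ^ 3 / (72 * sqrt 3)
           - 1 / 2 * S3 (2 * PI * sqrt 3)
           - 3 / 2 * S3 (2 * PI * sqrt 3 / 3).
Proof.
  assert (Hs : 0 < sqrt 3) by (apply sqrt_lt_R0; lra).
  assert (Hq : sqrt 3 * sqrt 3 = 3) by (apply sqrt_sqrt; lra).
  generalize (zeta_3_ramanujan (sqrt 3) Hs) PI_RGT_0. intros H HPI.
  assert (Hi : / sqrt 3 = sqrt 3 / 3).
  { apply (Rmult_eq_reg_l (sqrt 3)); [|lra]. rewrite Rinv_r by lra. lra. }
  replace (2 * PI * / sqrt 3) with (2 * PI * sqrt 3 / 3) in H by (rewrite Hi; field).
  set (A := S3 (2 * PI * sqrt 3)) in *. set (B := S3 (2 * PI * sqrt 3 / 3)) in *.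
  set (s := sqrt 3) in *.
  (* With c = pi / (2s), zeta(3) enters [H] with coefficient c from t = s and 3c from t = 1/s, in
     total 4c. *)
  apply (Rmult_eq_reg_l (4 * (PI / (2 * s)))).
  2:{ apply Rgt_not_eq. apply Rmult_lt_0_compat; [lra|]. apply Rdiv_lt_0_compat; lra. }
  replace (PI / (2 * / s)) with (3 * (PI / (2 * s))) in H
    by (rewrite <- Hq; field; lra).
  replace ((/ s) ^ 2) with (/ 3) in H by (rewrite <- Hq; field; lra).
  replace (s ^ 2) with 3 in H by (rewrite <- Hq; ring).
  replace (4 * (PI / (2 * s)) * (5 * PI ^ 3 / (72 * s) - 1 / 2 * A - 3 / 2 * B))
    with (5 * PI ^ 4 / (36 * (s * s)) - PI / (2 * s) * (2 * A + 6 * B)) by (field; lra).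
  (* The constants combine as 1/36 + 1/540 + 1/60 = 5/108, the coefficient of pi^4. *)
  rewrite Hq. set (c := PI / (2 * s)) in *. lra.
Qed.
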